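(* Let $P\bowtie G$ be a Zappa-Szép product of a right LCM semigroup $P$ and a group $G$, let $\mathcal{A}$ be a unital C*-algebra, and suppose that $X$ is a compactly aligned product system over $P$ with coefficient $\mathcal{A}$. Let $(X,G,\beta)$ be a Zappa-Szép system, let $\Psi$ be a representation of $X\bowtie G$ on a unital C*-algebra $\mathcal{B}$, and let $(\psi,U)$ be the covariant representation of $(X,G,\beta)$ corresponding to $\Psi$ under the one-to-one correspondence $\Pi$ between representations of $X\bowtie G$ and covariant representations of $(X,G,\beta)$ given by $\psi_p(x)=\Psi_{(p,e)}(x\otimes e)$ for $p\in P$, $x\in X_p$ and $U_g=\Psi_{(e,g)}(1_{\mathcal{A}}\otimes g)$ for $g\in G$, and conversely by $\Psi_{(p,g)}(x\otimes g)=\psi_p(x)U_g$ for $p\in P$, $g\in G$, $x\in X_p$. Then $\Psi$ is Nica-covariant if and only if $\psi$ is Nica-covariant.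
   Context: Semigroups and groups are discrete, and every semigroup has an identity, written $e$ (the identity of $G$ is also written $e$). Zappa-Szép product. One is given a left action $G\times P\to P$, $(g,p)\mapsto g\cdot p$, and a map $P\times G\to G$, $(p,g)\mapsto g|_p$, such that for all $g,h\in G$, $p,q\in P$: $e\cdot p=p$; $(gh)\cdot p=g\cdot(h\cdot p)$; $g\cdot e=e$; $g|_e=g$; $g\cdot(pq)=(g\cdot p)(g|_p\cdot q)$; $g|_{pq}=(g|_p)|_q$; $e|_p=e$; $(gh)|_p=g|_{h\cdot p}\,h|_p$. Then $P\bowtie G=P\times G$ with product $(p,g)(q,h)=(p(g\cdot q),\,g|_q h)$ is a semigroup with identity $(e,e)$. A left cancellative semigroup $P$ is right LCM if for all $p,q\in P$ either $pP\cap qP=\emptyset$ or $pP\cap qP=rP$ for some $r\in P$; if $P$ is right LCM then so is $P\bowtie G$ (known). Product system. An $\mathcal{A}$-correspondence is a right Hilbert $\mathcal{A}$-module with a left action of $\mathcal{A}$ by adjointable operators. A product system over a semigroup $P$ with coefficient $\mathcal{A}$ is $X=\bigsqcup_{p\in P}X_p$, with each $X_p$ an $\mathcal{A}$-correspondence, with an associative multiplication $X_p\times X_q\to X_{pq}$ such that (1) $X_e=\mathcal{A}$ as an $\mathcal{A}$-correspondence; (2) for all $p,q\in P$ the multiplication extends to a unitary $M_{p,q}:X_p\otimes X_q\to X_{pq}$ (interior tensor product over $\mathcal{A}$); (3) the left and right actions of $\mathcal{A}$ on $X_p$ coincide with the multiplications $X_e\times X_p\to X_p$ and $X_p\times X_e\to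 X_p$. Compact alignment. $\mathcal{L}(X_p)$ is the C*-algebra of adjointable operators, $\theta_{x,y}(z)=x\langle y,z\rangle$, and $\mathcal{K}(X_p)$ is the C*-subalgebra generated by the $\theta_{x,y}$. For $p,q\in P$ let $i_p^{pq}:\mathcal{L}(X_p)\to\mathcal{L}(X_{pq})$ be the $*$-homomorphism with $i_p^{pq}(S)(xy)=(Sx)y$ for $x\in X_p$, $y\in X_q$. A product system $X$ over a right LCM semigroup is compactly aligned if $S\vee T:=i_p^r(S)i_q^r(T)\in\mathcal{K}(X_r)$ whenever $S\in\mathcal{K}(X_p)$, $T\in\mathcal{K}(X_q)$ and $pP\cap qP=rP$. Zappa-Szép action of $G$ on $X$: a collection $\beta=\{\beta_g\}_{g\in G}$ of maps on $X$ such that (A1) for each $p\in P$, $g\in G$, $\beta_g$ restricts to a $\mathbb{C}$-linear map $X_p\to X_{g\cdot p}$; (A2) $\beta_g\circ\beta_h=\beta_{gh}$; (A3) $\beta_e$ is the identity; (A4) each $\beta_g$ is a $*$-automorphism of $X_e=\mathcal{A}$; (A5) $\beta_g(xy)=\beta_g(x)\beta_{g|_p}(y)$ for $x\in X_p$, $y\in X_q$; (A6) $\langle\beta_g(x),\beta_g(y)\rangle=\beta_{g|_p}(\langle x,y\rangle)$ for $x,y\in X_p$. The triple $(X,G,\beta)$ is then called a Zappa-Szép system. The product system $X\bowtie G$ over $P\bowtie G$ with coefficient $\mathcal{A}$: its fibre over $(p,g)$ is $Y_{(p,g)}=\{x\otimes g:x\in X_p\}$ with $a(x\otimes g)=ax\otimes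 g$, $(x\otimes g)a=x\beta_g(a)\otimes g$, $\langle x\otimes g,y\otimes g\rangle=\beta_{g^{-1}}(\langle x,y\rangle)$, and multiplication $(x\otimes g)(y\otimes h)=x\beta_g(y)\otimes g|_q h$ for $x\in X_p$, $y\in X_q$; $Y_{(e,e)}$ is identified with $\mathcal{A}$ via $a\otimes e\leftrightarrow a$. When $P$ is right LCM and $X$ is compactly aligned, $X\bowtie G$ is compactly aligned. A (Toeplitz) representation of a product system $X$ over $P$ on a C*-algebra $\mathcal{B}$ is a family $\psi=(\psi_p)_{p\in P}$ of linear maps $\psi_p:X_p\to\mathcal{B}$ such that $\psi_e$ is a $*$-homomorphism, $\psi_p(x)\psi_q(y)=\psi_{pq}(xy)$ for $x\in X_p,y\in X_q$, and $\psi_p(x)^*\psi_p(y)=\psi_e(\langle x,y\rangle)$ for $x,y\in X_p$. A representation $\psi$ induces homomorphisms $\psi^{(p)}:\mathcal{K}(X_p)\to\mathcal{B}$ with $\psi^{(p)}(\theta_{x,y})=\psi_p(x)\psi_p(y)^*$. A covariant representation of $(X,G,\beta)$ on a unital C*-algebra $\mathcal{B}$ is a pair $(\psi,U)$ of a representation $\psi$ of $X$ on $\mathcal{B}$ and a unitary representation $U$ of $G$ on $\mathcal{B}$ with $U_g\psi_p(x)=\psi_{g\cdot p}(\beta_g(x))U_{g|_p}$ for all $p\in P$, $g\in G$, $x\in X_p$. Nica covariance. A representation $\psi$ of a compactly aligned product system over a right LCM semigroup $P$ is Nica-covariant if for all $p,q\in P$, $S\in\mathcal{K}(X_p)$, $T\in\mathcal{K}(X_q)$: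 $\psi^{(p)}(S)\psi^{(q)}(T)=\psi^{(r)}(S\vee T)$ if $pP\cap qP=rP$, and $\psi^{(p)}(S)\psi^{(q)}(T)=0$ if $pP\cap qP=\emptyset$ (this does not depend on the choice of $r$). The same definition applies to $\Psi$ over $P\bowtie G$. *)

(* Defs.v *)
From HB Require Import structures.
From mathcomp Require Import all_boot all_order all_algebra.
From mathcomp Require Import complex.
From mathcomp Require Import all_classical all_reals all_analysis.

Set Implicit Arguments.
Unset Strict Implicit.
Unset Printing Implicit Defensive.

Import Order.TTheory GRing.Theory Num.Theory.
Local Open Scope classical_set_scope.
Local Open Scope complex_scope.
Local Open Scope ring_scope.

(** * Unital C*-algebras over [R[i]] *)

(* The hierarchy has no room for a structure below both [GRing.PzRing] and
   [CompleteNormedModule] that is not a [Num.NumDomain] (hence commutative);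
   this is why the multiplication below is not the one of [GRing].  The zero
   algebra is allowed. *)
HB.mixin Record isCStarAlgebra (R : realType) A
    of CompleteNormedModule R[i] A := {
  cmul : A -> A -> A;
  cone : A;
  star : A -> A;
  cmulA : associative cmul;
  cmul1r : left_id cone cmul;
  cmulr1 : right_id cone cmul;
  cmulDl : left_distributive cmul +%R;
  cmulDr : right_distributive cmul +%R;
  cmulZl : forall (c : R[i]) (a b : A), cmul (c *: a) b = c *: cmul a b;
  cmulZr : forall (c : R[i]) (a b : A), cmul a (c *: b) = c *: cmul a b;
  cnormM : forall a b : A, `|cmul a b| <= `|a| * `|b|;
  starD : forall a b : A, star (a + b) = star a + star b;
  starZ : forall (c : R[i]) (a : A), star (c *: a) = Num.conj c *: star a;
  starM : forall a b : A, star (cmul a b) = cmul (star b) (star a);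
  starK : involutive star;
  cstar_norm : forall a : A, `|cmul (star a) a| = `|a| ^+ 2
}.

#[short(type="cstarAlgType")]
HB.structure Definition CStarAlgebra (R : realType) :=
  {A of CompleteNormedModule R[i] A & isCStarAlgebra R A}.

Arguments cmul {R A} : rename.
Arguments cone {R A} : rename.
Arguments star {R A} : rename.

Notation "a ** b" := (cmul a b) (at level 40, left associativity) : ring_scope.

(* Not required to preserve the unit. *)
Definition is_star_hom (R : realType) (A B : cstarAlgType R) (f : A -> B) :=
  [/\ linear f,
      forall a b, f (a ** b) = f a ** f b &
      forall a, f (star a) = star (f a)].

Definition is_star_automorphism (R : realType) (A : cstarAlgType R)
    (f : A -> A) := is_star_hom f /\ bijective f.

(** * Hilbert modules and correspondences *)

(* [corr A] only collects the operations; the axioms are [is_hilbert_module]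
   and [is_correspondence] below. *)
Record corr (R : realType) (A : cstarAlgType R) := Corr {
  corr_sort :> lmodType R[i];
  inn : corr_sort -> corr_sort -> A;
  ract : corr_sort -> A -> corr_sort;
  lact : A -> corr_sort -> corr_sort }.

Arguments inn {R A E} x y : rename.
Arguments ract {R A E} x a : rename.
Arguments lact {R A E} a x : rename.

Section Correspondences.
Variables (R : realType) (A : cstarAlgType R).

Definition hnorm (E : corr A) (x : E) : R[i] := sqrtC `|inn x x|.

Definition hcomplete (E : corr A) :=
  forall u : nat -> E,
    (forall eps : R[i], 0 < eps -> exists N, forall m n,
       (N <= m)%N -> (N <= n)%N -> hnorm (u m - u n) < eps) ->
    exists l : E, forall eps : R[i], 0 < eps -> exists N, forall n,
      (N <= n)%N -> hnorm (u n - l) < eps.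

(* The inner product is linear in its second argument. *)
Record is_hilbert_module (E : corr A) : Prop := {
  ractDl : forall (x y : E) a, ract (x + y) a = ract x a + ract y a;
  ractDr : forall (x : E) a b, ract x (a + b) = ract x a + ract x b;
  ractZl : forall (c : R[i]) (x : E) a, ract (c *: x) a = c *: ract x a;
  ractZr : forall (c : R[i]) (x : E) a, ract x (c *: a) = c *: ract x a;
  ractM : forall (x : E) a b, ract x (a ** b) = ract (ract x a) b;
  ract1 : forall x : E, ract x cone = x;
  inn_linear : forall x : E, linear (inn x);
  inn_ract : forall (x y : E) a, inn x (ract y a) = inn x y ** a;
  inn_star : forall x y : E, star (inn x y) = inn y x;
  inn_ge0 : forall x : E, exists b, inn x x = star b ** b;
  inn_eq0 : forall x : E, inn x x = 0 -> x = 0;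
  inn_complete : hcomplete E }.

Definition is_adjoint (E F : corr A) (S : E -> F) (S' : F -> E) :=
  forall x y, inn (S x) y = inn x (S' y).

(* [adjointable E] is the carrier of L(E). *)
Definition adjointable (E : corr A) : set (E -> E) :=
  [set S | exists S', is_adjoint S S'].

Record is_correspondence (E : corr A) : Prop := {
  corr_hilbert : is_hilbert_module E;
  lact_linear : forall x : E, linear (fun a => lact a x);
  lactM : forall a b (x : E), lact (a ** b) x = lact a (lact b x);
  lact_adjoint : forall a, is_adjoint (@lact R A E a) (lact (star a)) }.

Definition is_unitary (E F : corr A) (M : E -> F) :=
  exists M' : F -> E, [/\ is_adjoint M M', cancel M M' & cancel M' M].

(* [t : E -> F -> T] exhibits the Hilbert module [T] as the interior tensor
   product of [E] and [F]: this is the completion of the span of the elementary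
   tensors for the inner product below.  That [t] is biadditive and balanced
   over [A] follows from the inner product formula. *)
Definition is_interior_tensor (E F T : corr A) (t : E -> F -> T) :=
  [/\ is_hilbert_module T,
      forall x y x' y', inn (t x y) (t x' y') = inn y (lact (inn x x') y') &
      forall (z : T) (eps : R[i]), 0 < eps ->
        exists s : seq (E * F), hnorm (z - \sum_(u <- s) t u.1 u.2) < eps].

Definition theta (E : corr A) (x y : E) : E -> E := fun z => ract x (inn y z).

(* C*-subalgebras of L(E); the last field is closedness for the operator
   norm. *)
Record is_cstar_subalgebra (E : corr A) (D : set (E -> E)) : Prop := {
  subalg_adjointable : D `<=` @adjointable E;
  subalg0 : D (fun=> 0);
  subalgD : forall S T, D S -> D T -> D (fun x => S x + T x);
  subalgZ : forall (c : R[i]) S, D S -> D (fun x => c *: S x);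
  subalgM : forall S T, D S -> D T -> D (S \o T);
  subalg_star : forall S S', D S -> is_adjoint S S' -> D S';
  subalg_closed : forall S, adjointable S ->
    (forall eps : R[i], 0 < eps -> exists2 T, D T &
       forall x, hnorm (S x - T x) <= eps * hnorm x) -> D S }.

Definition compacts (E : corr A) : set (E -> E) :=
  smallest (@is_cstar_subalgebra E) [set S | exists x y, S = theta x y].

End Correspondences.

(** * Right LCM semigroups *)

Definition rideal (P : monoidType) (p : P) : set P :=
  [set s | exists q, s = (p * q)%g].

Definition is_right_LCM (P : monoidType) :=
  (forall p : P, injective (fun q => (p * q)%g)) /\
  (forall p q : P, rideal p `&` rideal q = set0 \/
                   exists r, rideal p `&` rideal q = rideal r).

(** * Product systems *)

(* The operations of a product system; the axioms are [is_product_system].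
   [ps_unit] and [ps_unitV] are the identification of the coefficient algebra
   with the fibre over the identity. *)
Record product_system (R : realType) (A : cstarAlgType R) (P : monoidType) :=
  ProductSystem {
    fibre :> P -> corr A;
    ps_mul : forall p q, fibre p -> fibre q -> fibre (p * q)%g;
    ps_unit : A -> fibre 1%g;
    ps_unitV : fibre 1%g -> A }.

Arguments ps_mul {R A P X p q} x y : rename.
Arguments ps_unit {R A P X} a : rename.
Arguments ps_unitV {R A P X} x : rename.

Section ProductSystems.
Variables (R : realType) (A B : cstarAlgType R) (P : monoidType).
Implicit Type X : product_system A P.

(* The inclusion of a fibre in the disjoint union of all the fibres; equations
   between elements of fibres whose indices are only provably equal are stated
   there. *)
Definition elt X (p : P) (x : X p) : {p : P & X p} :=
  existT (fun p => X p : Type) p x.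

Record is_product_system X : Prop := {
  ps_corr : forall p, is_correspondence (X p);
  ps_mulA : forall p q s (x : X p) (y : X q) (z : X s),
    elt (ps_mul (ps_mul x y) z) = elt (ps_mul x (ps_mul y z));
  ps_unitK : cancel (@ps_unit R A P X) ps_unitV;
  ps_unitVK : cancel (@ps_unitV R A P X) ps_unit;
  ps_unit_linear : linear (@ps_unit R A P X);
  ps_unit_inn : forall a b, inn (@ps_unit R A P X a) (ps_unit b) = star a ** b;
  ps_unit_ract : forall a b, ract (@ps_unit R A P X a) b = ps_unit (a ** b);
  ps_unit_lact : forall a b, lact a (@ps_unit R A P X b) = ps_unit (a ** b);
  ps_mul_unitary : forall p q, exists (T : corr A) (t : X p -> X q -> T),
    is_interior_tensor t /\
    exists M : T -> X (p * q)%g,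
      is_unitary M /\ forall x y, M (t x y) = ps_mul x y;
  ps_lactE : forall p (a : A) (x : X p),
    elt (ps_mul (ps_unit a) x) = elt (lact a x);
  ps_ractE : forall p (a : A) (x : X p),
    elt (ps_mul x (ps_unit a)) = elt (ract x a) }.

(* For r = p q this is i_p^r : L(X_p) -> L(X_r); by left cancellation of [P]
   such a q is unique. *)
Definition ps_incl X (p r : P) (S : X p -> X p) : X r -> X r :=
  @xget {classic X r -> X r} id [set S' : X r -> X r | adjointable S' /\
    forall q (x : X p) (y : X q) (z : X r),
      elt z = elt (ps_mul x y) -> elt (S' z) = elt (ps_mul (S x) y)].

Arguments ps_incl {X p} r S.

Definition ps_join X (p q r : P) (S : X p -> X p) (T : X q -> X q) :
  X r -> X r := ps_incl r S \o ps_incl r T.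

Arguments ps_join {X p q} r S T.

Definition is_compactly_aligned X :=
  forall p q r (S : X p -> X p) (T : X q -> X q),
    rideal p `&` rideal q = rideal r ->
    compacts S -> compacts T -> compacts (ps_join r S T).

Record is_representation X (psi : forall p, X p -> B) : Prop := {
  rep_linear : forall p, linear (psi p);
  rep_unit : is_star_hom (fun a : A => psi 1%g (ps_unit a));
  rep_mul : forall p q (x : X p) (y : X q),
    psi p x ** psi q y = psi (p * q)%g (ps_mul x y);
  rep_inn : forall p (x y : X p),
    star (psi p x) ** psi p y = psi 1%g (ps_unit (inn x y)) }.

(* [phi] restricts to a *-homomorphism on K(X_p) with the prescribed values on
   rank one operators; its restriction is then unique, because *-homomorphisms
   are continuous.  Its values outside K(X_p) are irrelevant. *)
Record is_induced X (psi : forall p, X p -> B) (p : P)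
    (phi : (X p -> X p) -> B) : Prop := {
  inducedD : forall S T, compacts S -> compacts T ->
    phi (fun x => S x + T x) = phi S + phi T;
  inducedZ : forall (c : R[i]) S, compacts S ->
    phi (fun x => c *: S x) = c *: phi S;
  inducedM : forall S T, compacts S -> compacts T ->
    phi (S \o T) = phi S ** phi T;
  induced_star : forall S S', compacts S -> is_adjoint S S' ->
    phi S' = star (phi S);
  induced_theta : forall x y, phi (theta x y) = psi p x ** star (psi p y) }.

Definition rep_compacts X (psi : forall p, X p -> B) (p : P) :
  (X p -> X p) -> B :=
  @xget {classic (X p -> X p) -> B} (fun=> 0)
    [set phi : (X p -> X p) -> B | is_induced psi phi].

Definition is_Nica_covariant X (psi : forall p, X p -> B) :=
  forall p q (S : X p -> X p) (T : X q -> X q), compacts S -> compacts T ->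
    (forall r, rideal p `&` rideal q = rideal r ->
       rep_compacts psi S ** rep_compacts psi T =
       rep_compacts psi (ps_join r S T)) /\
    (rideal p `&` rideal q = set0 ->
       rep_compacts psi S ** rep_compacts psi T = 0).

End ProductSystems.

(** * Zappa-Szép products *)

Record zappa_szep (P : monoidType) (G : groupType) := ZappaSzep {
  zact : G -> P -> P;
  zres : P -> G -> G;
  zact1p : forall p, zact 1%g p = p;
  zactM : forall g h p, zact (g * h)%g p = zact g (zact h p);
  zactp1 : forall g, zact g 1%g = 1%g;
  zres1g : forall g, zres 1%g g = g;
  zact_mul : forall g p q,
    zact g (p * q)%g = (zact g p * zact (zres p g) q)%g;
  zresM : forall p q g, zres (p * q)%g g = zres q (zres p g);
  zresp1 : forall p, zres p 1%g = 1%g;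
  zres_mul : forall p g h,
    zres p (g * h)%g = (zres (zact h p) g * zres p h)%g }.

Definition zs_prod (P : monoidType) (G : groupType) (Z : zappa_szep P G) :
  Type := (P * G)%type.

Section ZappaSzepProduct.
Variables (P : monoidType) (G : groupType) (Z : zappa_szep P G).

HB.instance Definition _ := Choice.copy (zs_prod Z) (P * G)%type.

Definition zs_mul (u v : zs_prod Z) : zs_prod Z :=
  ((u.1 * zact Z u.2 v.1)%g, (zres Z v.1 u.2 * v.2)%g).

Definition zs_one : zs_prod Z := (1%g, 1%g).

Lemma zs_mulA : associative zs_mul.
Proof.
move=> [p g] [q h] [r k]; rewrite /zs_mul /=; congr pair.
  by rewrite zact_mul zactM mulgA.
by rewrite zres_mul zresM mulgA.
Qed.

Lemma zs_mul1 : left_id zs_one zs_mul.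
Proof. by move=> [p g]; rewrite /zs_mul /= zact1p zresp1 !mul1g. Qed.

Lemma zs_mulr1 : right_id zs_one zs_mul.
Proof. by move=> [p g]; rewrite /zs_mul /= zactp1 zres1g !mulg1. Qed.

HB.instance Definition _ := isMonoid.Build (zs_prod Z) zs_mulA zs_mul1 zs_mulr1.

End ZappaSzepProduct.

(** * Zappa-Szép systems *)

Section ZappaSzepSystems.
Variables (R : realType) (A B : cstarAlgType R).
Variables (P : monoidType) (G : groupType) (Z : zappa_szep P G).
Variable X : product_system A P.
Implicit Type beta : forall (g : G) (p : P), X p -> X (zact Z g p).

(* The map induced by [beta g] on the coefficient algebra, through the
   identification of the latter with the fibre over the identity. *)
Definition beta_coef beta (g : G) (a : A) : A :=
  ps_unitV (ecast p (X p) (zactp1 Z g) (beta g 1%g (ps_unit a))).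

Record is_zs_action beta : Prop := {
  beta_linear : forall g p, linear (beta g p);
  beta_comp : forall g h p (x : X p),
    elt (beta g _ (beta h p x)) = elt (beta (g * h)%g p x);
  beta_1 : forall p (x : X p), elt (beta 1%g p x) = elt x;
  beta_automorphism : forall g, is_star_automorphism (beta_coef beta g);
  beta_mul : forall g p q (x : X p) (y : X q),
    elt (beta g _ (ps_mul x y)) =
    elt (ps_mul (beta g p x) (beta (zres Z p g) q y));
  beta_inn : forall g p (x y : X p),
    inn (beta g p x) (beta g p y) =
    beta_coef beta (zres Z p g) (inn x y) }.

(* The fibre of X ⋈ G over (p, g): the element x ⊗ g is represented by x. *)
Definition zs_fibre beta (u : zs_prod Z) : corr A :=
  @Corr R A (X u.1)
    (fun x y => beta_coef beta u.2^-1%g (inn x y))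
    (fun x a => ract x (beta_coef beta u.2 a))
    (fun a x => lact a x).

(* The product system X ⋈ G. *)
Definition zs_system beta : product_system A (zs_prod Z) :=
  @ProductSystem R A (zs_prod Z) (zs_fibre beta)
    (fun u v (x : X u.1) (y : X v.1) => ps_mul x (beta u.2 v.1 y))
    (@ps_unit R A P X) (@ps_unitV R A P X).

Definition otimes beta (p : P) (x : X p) (g : G) : zs_system beta (p, g) := x.

Record is_unitary_representation (U : G -> B) : Prop := {
  urep1 : U 1%g = cone;
  urepM : forall g h, U (g * h)%g = U g ** U h;
  urep_isometry : forall g, star (U g) ** U g = cone;
  urep_coisometry : forall g, U g ** star (U g) = cone }.

Record is_covariant_representation beta (psi : forall p, X p -> B)
    (U : G -> B) : Prop := {
  cov_rep : is_representation psi;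
  cov_unitary : is_unitary_representation U;
  cov_commute : forall p g (x : X p),
    U g ** psi p x = psi (zact Z g p) (beta g p x) ** U (zres Z p g) }.

(* (psi, U) corresponds to Psi under the bijection between representations of
   X ⋈ G and covariant representations of (X, G, beta). *)
Record corresponds beta (Psi : forall u, zs_system beta u -> B)
    (psi : forall p, X p -> B) (U : G -> B) : Prop := {
  corresponds_psi : forall p (x : X p), psi p x = Psi (p, 1%g) (otimes beta x 1%g);
  corresponds_U : forall g, U g = Psi (1%g, g) (otimes beta (ps_unit cone) g);
  corresponds_Psi : forall p g (x : X p),
    Psi (p, g) (otimes beta x g) = psi p x ** U g }.

End ZappaSzepSystems.

(* Main.v *)
Require Import Defs.
From HB Require Import structures.
From mathcomp Require Import all_boot all_order all_algebra.
From mathcomp Require Import complex.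
From mathcomp Require Import all_classical all_reals all_analysis.
From mathcomp Require Import ring lra.

Set Implicit Arguments.
Unset Strict Implicit.
Unset Printing Implicit Defensive.

Import Order.TTheory GRing.Theory Num.Theory numFieldNormedType.Exports.
Local Open Scope classical_set_scope.
Local Open Scope complex_scope.
Local Open Scope ring_scope.

(* The fibre of X ⋈ G over (p, g) is X_p with its inner product twisted by the
   *-automorphism β_{g^-1} and its right action by β_g.  The twists cancel in
   θ_{x,y}, and *-automorphisms are isometric, so that both modules have the same
   compact operators; as U_g is unitary, Ψ^{(p,g)} and ψ^{(p)} agree on them.
   Moreover (p, g)(P ⋈ G) = pP × G and i_{(p,g)}^{(r,k)} = i_p^r, so the two Nica
   conditions coincide term by term. *)

(** * Real-valued norms, and square roots by fixed-point iteration *)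

Section RealNorm.
Variables (R : realType) (A : cstarAlgType R).
Implicit Types (a b x y z : A) (t : R).

(* The norm [`|a|] takes its values in [R[i]]. *)
Definition nr a : R := complex.Re `|a|.

Lemma nrE a : `|a| = (nr a)%:C.
Proof. by rewrite /nr RRe_real // normr_real. Qed.

Lemma nr_ge0 a : 0 <= nr a.
Proof. by rewrite -ler0c -nrE. Qed.

Lemma nrD a b : nr (a + b) <= nr a + nr b.
Proof. by rewrite -lecR rmorphD /= -!nrE ler_normD. Qed.

Lemma nrN a : nr (- a) = nr a.
Proof. by rewrite /nr normrN. Qed.

Lemma nr0 : nr 0 = 0.
Proof. by rewrite /nr normr0. Qed.

Lemma nrM a b : nr (a ** b) <= nr a * nr b.
Proof. by rewrite -lecR rmorphM /= -!nrE cnormM. Qed.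

Lemma nrZ (c : R[i]) a : nr (c *: a) = complex.Re `|c| * nr a.
Proof.
by apply: complexI; rewrite rmorphM /= -!nrE normrZ (RRe_real (normr_real c)).
Qed.

Lemma nrZr t a : nr (t%:C *: a) = `|t| * nr a.
Proof. by rewrite nrZ normc_def /= expr0n addr0 sqrtr_sqr. Qed.

Lemma nr_eq0 a : nr a = 0 -> a = 0.
Proof. by move=> a0; apply/eqP; rewrite -normr_eq0 nrE a0. Qed.

Lemma nr_eps0 a : (forall e : R, 0 < e -> nr a <= e) -> a = 0.
Proof.
move=> ae; apply/nr_eq0/eqP; rewrite eq_le nr_ge0 andbT.
by apply/ler_addgt0Pr => e e0; rewrite add0r ae.
Qed.

Lemma nr_starM a : nr (star a ** a) = nr a ^+ 2.
Proof. by apply: complexI; rewrite rmorphXn /= -!nrE cstar_norm. Qed.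

(** The C*-identity gives [nr b ^+ 2 <= nr (star b) * nr b]; cancel [nr b], then exchange [b] and
    [star b]. *)
Lemma nr_star a : nr (star a) = nr a.
Proof.
have le b : nr b <= nr (star b).
  have := nrM (star b) b; rewrite nr_starM expr2 => h.
  have [->|b0] := eqVneq (nr b) 0; first exact: nr_ge0.
  by rewrite -(ler_pM2r (_ : 0 < nr b)) // lt_neqAle eq_sym b0 nr_ge0.
by apply/eqP; rewrite eq_le le -{2}(starK a) le.
Qed.

Lemma cmulNl a b : (- a) ** b = - (a ** b).
Proof. by rewrite -scaleN1r cmulZl scaleN1r. Qed.

Lemma cmulNr a b : a ** (- b) = - (a ** b).
Proof. by rewrite -scaleN1r cmulZr scaleN1r. Qed.

Lemma cmulBl a b x : (a - b) ** x = a ** x - b ** x.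
Proof. by rewrite cmulDl cmulNl. Qed.

Lemma cmulBr a b x : x ** (a - b) = x ** a - x ** b.
Proof. by rewrite cmulDr cmulNr. Qed.

Lemma star_one : star cone = cone :> A.
Proof. by rewrite -[LHS]cmulr1 -{2}[cone]starK -starM cmulr1 starK. Qed.

Lemma cmul0r a : 0 ** a = 0.
Proof. by rewrite -{1}(scale0r (0 : A)) cmulZl scale0r. Qed.

Lemma cmulr0 a : a ** 0 = 0.
Proof. by rewrite -{1}(scale0r (0 : A)) cmulZr scale0r. Qed.

Lemma star0 : star 0 = 0 :> A.
Proof. by rewrite -{1}(scale0r (0 : A)) starZ rmorph0 scale0r. Qed.

Lemma starN a : star (- a) = - star a.
Proof. by rewrite -scaleN1r starZ rmorphN rmorph1 scaleN1r. Qed.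

Lemma starB a b : star (a - b) = star a - star b.
Proof. by rewrite starD starN. Qed.

Lemma starZr t a : star (t%:C *: a) = t%:C *: star a.
Proof. by rewrite starZ conj_Creal //; apply/complex_realP; exists t. Qed.

(** [cone] is a self-adjoint idempotent, so its norm equals its own square: it is 1, or 0 in the
    zero algebra. *)
Lemma nr_one : nr (cone : A) <= 1.
Proof.
have := nr_starM cone; rewrite star_one cmul1r expr2 => h.
have [->//|n0] := eqVneq (nr (cone : A)) 0.
by move: h; rewrite -{1}[nr _]mulr1 => /(mulfI n0) <-.
Qed.

Lemma nr_isometry a : star a ** a = cone -> nr a <= 1.
Proof.
move=> h; rewrite -(@expr_le1 _ 2) ?nr_ge0 // -nr_starM h; exact: nr_one.
Qed.

Lemma geometric_cvg (u : nat -> A) (s : R) : 0 <= s < 1 ->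
  (forall n m, nr (u (m + n)%N - u n) <= s ^+ n) ->
  exists l, forall e : R, 0 < e -> exists N, forall n, (N <= n)%N ->
    nr (l - u n) <= e.
Proof.
move=> /andP[s0 s1] hu.
have su : cvg (u @ \oo).
  apply/cauchy_cvgP/cauchy_exP => e e0.
  have re : (complex.Re e)%:C = e by rewrite RRe_real // gtr0_real.
  have re0 : 0 < complex.Re e by rewrite -ltcR re.
  have : s ^+ n @[n --> \oo] --> (0 : R) by apply: cvg_expr; rewrite ger0_norm.
  move=> /cvgrPdist_lt /(_ _ re0) [N _ /(_ N (leqnn N))] /=.
  rewrite sub0r normrN ger0_norm ?exprn_ge0 // => sN.
  exists (u N); exists N => // n /= Nn; rewrite -ball_normE /=.
  rewrite -re distrC nrE ltcR (le_lt_trans _ sN) //.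
  by rewrite -(subnK Nn) hu.
exists (lim (u @ \oo)) => e e0.
have /cvgrPdist_lt /(_ e%:C) := su; rewrite ltcR => /(_ e0) [N _ h].
by exists N => n Nn; have := h n Nn; rewrite /= nrE ltcR => /ltW.
Qed.

(* The fixed point [l] of [y |-> (x + y^2) / 2], a contraction of the ball of
   radius [nr x] < 1, satisfies (1 - l)^2 = 1 - x. *)
Lemma sqrt_one_sub x : star x = x -> nr x < 1 ->
  exists c, [/\ star c = c, c ** c = cone - x &
                forall h, h ** x = x ** h -> h ** c = c ** h].
Proof.
move=> sx x1; set s := nr x in x1; have s0 : 0 <= s := nr_ge0 x.
pose F y := (2^-1 : R)%:C *: (x + y ** y).
have half (a : A) : nr ((2^-1 : R)%:C *: a) = 2^-1 * nr a.
  by rewrite nrZr ger0_norm // invr_ge0.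
have sqB y z : nr (y ** y - z ** z) <= (nr y + nr z) * nr (y - z).
  rewrite (_ : y ** y - z ** z = y ** (y - z) + (y - z) ** z); last first.
    by rewrite cmulBl cmulBr addrA subrK.
  apply: (le_trans (nrD _ _)); rewrite mulrDl lerD ?nrM //.
  by rewrite mulrC nrM.
have FB y z : nr (F y - F z) <= 2^-1 * ((nr y + nr z) * nr (y - z)).
  rewrite -scalerBr half ler_pM2l ?invr_gt0 //.
  by rewrite opprD addrACA subrr add0r.
pose u n := iter n F 0.
(* [F] maps the ball of radius [s] into itself, since [(s + s^2) / 2 <= s]. *)
have us n : nr (u n) <= s.
  elim: n => [|n IH]; first by rewrite nr0.
  rewrite /u /= -/(u n) half.
  have := nrD x (u n ** u n); have := nrM (u n) (u n); have := nr_ge0 (u n).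
  rewrite -/s; nra.
(* On that ball [F] is Lipschitz with constant [(s + s) / 2 = s], so each iteration gains a factor
   [s]. *)
have uB n m : nr (u (m + n)%N - u n) <= s ^+ n.
  elim: n m => [|n IH] m; first by rewrite subr0 expr0 (le_trans (us _)) // ltW.
  rewrite addnS /u /= -/(u n) -/(u (m + n)%N) exprS.
  apply: (le_trans (FB _ _)).
  have := us n; have := us (m + n)%N; have := IH m.
  have := nr_ge0 (u (m + n)%N - u n); nra.
have [|l hl] := @geometric_cvg u s _ uB; first by rewrite s0.
have lu e : 0 < e -> exists n, nr (l - u n) <= e /\ nr (l - u n.+1) <= e.
  by move=> /hl[N h]; exists N; split; apply: h.
have sl : star l = l.
  apply/eqP; rewrite -subr_eq0; apply/eqP/nr_eps0 => e e0.
  have su n : star (u n) = u n.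
    elim: n => [|n IH]; first exact: star0.
    by rewrite /u /= -/(u n) starZr starD sx starM IH.
  have [|n [h _]] := lu (e / 2); first by rewrite divr_gt0.
  rewrite -(subrKA (u n)) -{1}[u n]su -starB.
  have := nrD (star (l - u n)) (u n - l).
  rewrite nr_star -(opprB l (u n)) nrN; lra.
have Fl : F l = l.
  apply/eqP; rewrite -subr_eq0; apply/eqP/nr_eps0 => e e0.
  (* As [d <= 1] gives [nr l <= 2], the norm of [F l - u n.+1] is at most [3 d / 2], and that of
     [F l - l] at most [5 d / 2 <= e]. *)
  pose d := Num.min (e / 3) 1.
  have d0 : 0 < d by rewrite lt_min ltr01 divr_gt0.
  have de : d <= e / 3 by rewrite ge_min lexx.
  have d1 : d <= 1 by rewrite ge_min lexx orbT.
  have [n [h h']] := lu _ d0.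
  rewrite -(subrKA (u n.+1)) -(opprB l (u n.+1)).
  have := nrD (F l - u n.+1) (- (l - u n.+1)); rewrite nrN.
  have := FB l (u n); rewrite -/(u n.+1) => hF.
  have l2 : nr l <= 2.
    by have := nrD (l - u n) (u n); have := us n; rewrite subrK; lra.
  have := nr_ge0 (l - u n); have := us n; have := nr_ge0 (u n).
  have := nr_ge0 l; nra.
exists (cone - l); split; first by rewrite starB star_one sl.
- have l2 : l + l = x + l ** l.
    rewrite -{1 2}Fl /F -mulr2n -scaler_nat -(rmorph_nat (real_complex R)).
    by rewrite scalerA -rmorphM mulfV ?pnatr_eq0 // rmorph1 scale1r.
  rewrite cmulBl !cmulBr !cmul1r !cmulr1 -addrA; congr (_ + _).
  by rewrite -opprD addrA l2 addrK.
- move=> h hx; rewrite cmulBl cmulBr cmul1r cmulr1; congr (_ - _).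
  (* Every iterate is a polynomial in [x], hence commutes with [h]; this passes to the limit [l]. *)
  have hu n : h ** u n = u n ** h.
    elim: n => [|n IH]; first by rewrite /u /= cmul0r cmulr0.
    rewrite /u /= -/(u n) cmulZl cmulZr cmulDl cmulDr hx.
    by rewrite cmulA IH -cmulA IH cmulA.
  apply/eqP; rewrite -subr_eq0; apply/eqP/nr_eps0 => e e0.
  (* Adding 1 keeps the divisor positive when [nr h = 0]; each of the two products is then at most
     [e / 2]. *)
  pose k := nr h + 1; have k0 : 0 < k by rewrite ltr_wpDl ?nr_ge0.
  have [|n [hn _]] := lu (e / (2 * k)); first by rewrite divr_gt0 ?mulr_gt0.
  have -> : h ** l - l ** h = h ** (l - u n) - (l - u n) ** h.
    by rewrite cmulBl cmulBr hu opprB addrA subrK.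
  have := nrD (h ** (l - u n)) (- ((l - u n) ** h)); rewrite nrN.
  have := nrM h (l - u n); have := nrM (l - u n) h.
  have : nr h * nr (l - u n) <= e / 2.
    rewrite (_ : e / 2 = k * (e / (2 * k))); last by field; rewrite gt_eqF.
    by rewrite ler_pM ?nr_ge0 // lerDl.
  rewrite (mulrC (nr (l - u n))); lra.
Qed.

End RealNorm.

(** * Norm estimates for unital *-homomorphisms *)

Section StarHomNorm.
Variables (R : realType) (A B : cstarAlgType R).

Lemma star_homZ (f : A -> B) (k : R[i]) (a : A) : is_star_hom f ->
  f (k *: a) = k *: f a.
Proof.
move=> [fL _ _]; have f0 : f 0 = 0.
  by have := fL (-1) 0 0; rewrite scaler0 addr0 scaleN1r addNr.
by have := fL k a 0; rewrite f0 !addr0.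
Qed.

(* If [nr h < 1] then [h] is the mean of the unitaries [h + i c] and [h - i c]
   with [c = sqrt (1 - h^2)], and unital *-homomorphisms preserve unitaries. *)
Lemma star_hom_selfadjoint_le1 (f : A -> B) (h : A) : is_star_hom f ->
  f cone = cone -> star h = h -> nr h < 1 -> nr (f h) <= 1.
Proof.
move=> hf f1 sh h1; have [fL fM fS] := hf.
have [||c [sc cc /(_ h (cmulA h h h)) hc]] := @sqrt_one_sub R A (h ** h).
- by rewrite starM sh.
- by apply: (le_lt_trans (nrM h h)); have := nr_ge0 h; nra.
pose u := h + 'i *: c.
have su : star u = h - 'i *: c by rewrite starD starZ sh sc conjCi scaleNr.
(* The product is [h^2 + c^2] plus ['i] times the commutator of [h] and [c], which vanishes by
   [hc]. *)
have uu : star u ** u = cone.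
  rewrite su cmulBl !cmulDr !cmulZl !cmulZr hc scalerA -expr2 sqrCi scaleN1r.
  by rewrite opprD opprK addrA addrK cc addrC subrK.
have fuu : star (f u) ** f u = cone by rewrite -fS -fM uu f1.
have fZ k b := star_homZ k b hf.
have fD a b : f (a + b) = f a + f b by have := fL 1 a b; rewrite !scale1r.
have fh : f h = (2^-1 : R)%:C *: (f u + star (f u)).
  rewrite -fS su -fD -fZ; congr f.
  rewrite /u addrACA subrr addr0 -mulr2n -(scaler_nat 2 h).
  rewrite -(rmorph_nat (real_complex R)) scalerA -rmorphM mulVf ?pnatr_eq0 //.
  by rewrite rmorph1 scale1r.
rewrite fh nrZr ger0_norm ?invr_ge0 //.
have := nrD (f u) (star (f u)); rewrite nr_star; have := nr_isometry fuu; lra.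
Qed.

(** By the C*-identity it suffices to bound [f] on the self-adjoint [star a ** a]; dividing by its
    norm plus [e] brings it into the open unit ball, and [e] is arbitrary. *)
Lemma star_hom_contractive (f : A -> B) (a : A) : is_star_hom f ->
  f cone = cone -> nr (f a) <= nr a.
Proof.
move=> hf f1; have [fL fM fS] := hf.
have fZ k b := star_homZ k b hf.
rewrite -(@ler_pXn2r _ 2) ?nnegrE ?nr_ge0 // -!nr_starM -fS -fM.
set h := star a ** a.
have sh : star h = h by rewrite starM starK.
apply/ler_addgt0Pr => e e0; set t := nr h + e.
have t0 : 0 < t by rewrite ltr_wpDl ?nr_ge0.
have nt (C : cstarAlgType R) (b : C) : nr (t^-1%:C *: b) = nr b / t.
  by rewrite nrZr ger0_norm ?invr_ge0 1?ltW // mulrC.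
have := @star_hom_selfadjoint_le1 f (t^-1%:C *: h) hf f1.
rewrite starZr sh fZ !nt ltr_pdivrMr // ler_pdivrMr // !mul1r; apply => //.
by rewrite ltrDl.
Qed.

End StarHomNorm.

(** The inverse of [f] is again a unital *-homomorphism, so both are contractive. *)
Lemma star_automorphism_norm (R : realType) (A : cstarAlgType R) (f : A -> A)
  (a : A) : is_star_automorphism f -> `|f a| = `|a|.
Proof.
move=> [hf [g fK gK]]; have [fL fM fS] := hf.
have hg : is_star_hom g.
  split=> [k b c|b c|b]; apply: (can_inj fK).
  - by rewrite fL !gK.
  - by rewrite fM !gK.
  - by rewrite fS !gK.
have f1 : f cone = cone by rewrite -[LHS]cmulr1 -{2}[cone]gK -fM cmul1r gK.
have g1 : g cone = cone by rewrite -[in LHS]f1 fK.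
rewrite !nrE; congr (_%:C); apply/eqP.
by rewrite eq_le star_hom_contractive //= -{1}[a]fK star_hom_contractive.
Qed.

(** * Fibres of X ⋈ G compared with fibres of X *)

Section ZappaSzepSystem.
Variables (R : realType) (A B : cstarAlgType R).
Variables (P : monoidType) (G : groupType) (Z : zappa_szep P G).
Variable X : product_system A P.
Variable beta : forall (g : G) (p : P), X p -> X (zact Z g p).
Hypothesis hX : is_product_system X.
Hypothesis hbeta : is_zs_action beta.
Implicit Types (u v r : zs_prod Z).
Local Notation Y := (zs_system beta).
Local Notation coef := (beta_coef beta).

(** This carries operations across fibres whose indices are only provably equal, without casts. *)
Lemma elt_congr (T : Type) (F : forall p, X p -> T) p q (x : X p) (y : X q) :
  elt x = elt y -> F p x = F q y.
Proof. by move=> /(congr1 (fun s => F (projT1 s) (projT2 s))). Qed.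

Lemma elt_ecast p q (e : p = q) (x : X p) : elt (ecast p (X p) e x) = elt x.
Proof. by case: _ / e. Qed.

(** The fibre over [u] has the carrier of [X u.1], so once the indices agree only the equality over
    [P] remains. *)
Lemma elt_zs u v (z : Y u) (w : Y v) :
  elt z = elt w <-> u = v /\ @elt R A P X u.1 z = @elt R A P X v.1 w.
Proof.
split=> [zw|[uv]].
  split; first exact: (congr1 (@projT1 _ _) zw).
  exact: (congr1 (fun s : {u & Y u} => @elt R A P X (projT1 s).1 (projT2 s)) zw).
case: _ / uv in w * => zw; have {}zw := existT_inj2 zw.
exact: (congr1 (fun x : Y u => elt x) zw).
Qed.

Lemma elt_beta_coef g a :
  elt (ps_unit (coef g a) : X 1%g) = elt (beta g (ps_unit a : X 1%g)).
Proof. by rewrite /beta_coef (ps_unitVK hX) elt_ecast. Qed.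

Lemma ps_unit_inj (a b : A) : elt (ps_unit a : X 1%g) = elt (ps_unit b) -> a = b.
Proof. by move=> ab; apply: (can_inj (ps_unitK hX)); apply: existT_inj2 ab. Qed.

Lemma beta_coef1 a : coef 1%g a = a.
Proof. by apply: ps_unit_inj; rewrite elt_beta_coef (beta_1 hbeta). Qed.

Lemma beta_coefM g h a : coef g (coef h a) = coef (g * h)%g a.
Proof.
apply: ps_unit_inj; rewrite !elt_beta_coef -(beta_comp hbeta).
exact: (elt_congr (fun p x => elt (beta g x))) (elt_beta_coef h a).
Qed.

Lemma beta_coefVK g : cancel (coef g^-1%g) (coef g).
Proof. by move=> a; rewrite beta_coefM mulgV beta_coef1. Qed.

(** [coef u.2^-1%g] is injective, so it can be stripped from both sides of the adjoint relation. *)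
Lemma zs_adjoint u (S S' : X u.1 -> X u.1) :
  @is_adjoint R A (Y u) (Y u) S S' <-> is_adjoint S S'.
Proof.
split=> h x y; last by rewrite /= h.
exact: (can_inj (beta_coefVK u.2)) (h x y).
Qed.

Lemma zs_adjointable u : @adjointable R A (Y u) = @adjointable R A (X u.1).
Proof.
by apply/seteqP; split=> S [S' hS]; exists S'; apply/zs_adjoint.
Qed.

(** The isometry of *-automorphisms enters here; it makes the closedness clause of
    [is_cstar_subalgebra] the same for both modules. *)
Lemma zs_hnorm u : @hnorm R A (Y u) = @hnorm R A (X u.1).
Proof.
apply/funext => x; rewrite /hnorm /=.
by rewrite (star_automorphism_norm _ (beta_automorphism hbeta _)).
Qed.

Lemma zs_theta u : @theta R A (Y u) = @theta R A (X u.1).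
Proof.
by apply/funext => x; apply/funext => y; apply/funext => z;
  rewrite /theta /= beta_coefVK.
Qed.

Lemma zs_cstar_subalgebra u :
  @is_cstar_subalgebra R A (Y u) = @is_cstar_subalgebra R A (X u.1).
Proof.
apply/funext => D; apply/propext; split=> -[Da D0 DD DZ DM Ds Dc].
  split=> //.
  - by rewrite -zs_adjointable.
  - by move=> S S' /Ds DS ?; apply/DS/zs_adjoint.
  - by rewrite zs_adjointable zs_hnorm in Dc.
split=> //.
- by rewrite zs_adjointable.
- by move=> S S' /Ds DS ?; apply/DS/zs_adjoint.
- by rewrite zs_adjointable zs_hnorm.
Qed.

Lemma zs_compacts u : @compacts R A (Y u) = @compacts R A (X u.1).
Proof. by rewrite /compacts zs_cstar_subalgebra zs_theta. Qed.

(** * Right ideals and inclusion maps *)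

Lemma zs_mulE u v :
  (u * v)%g = ((u.1 * zact Z u.2 v.1)%g, (zres Z v.1 u.2 * v.2)%g).
Proof. by []. Qed.

Lemma rideal_zs u s : rideal u s <-> rideal u.1 s.1.
Proof.
split=> [[t ->]|[q sq]]; first by exists (zact Z u.2 t.1).
(* Solve [u * t = s] for [t]: [u.2] acts bijectively on [P], which gives [t.1], and then [t.2]
   solves an equation in [G]. *)
exists (zact Z u.2^-1%g q, (zres Z (zact Z u.2^-1%g q) u.2)^-1%g * s.2)%g.
rewrite [s]surjective_pairing sq zs_mulE /=.
by rewrite -zactM mulgV zact1p mulgA mulgV mul1g.
Qed.

Lemma rideal_zsI u v r :
  rideal u `&` rideal v = rideal r <-> rideal u.1 `&` rideal v.1 = rideal r.1.
Proof.
split=> /seteqP[h h']; apply/seteqP; split=> s.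
- move=> [su sv]; apply/(@rideal_zs r (s, 1%g)); apply: h.
  by split; apply/rideal_zs.
- move=> /(@rideal_zs r (s, 1%g)) /h' [/rideal_zs su /rideal_zs sv].
  by split.
- by move=> [/rideal_zs su /rideal_zs sv]; apply/rideal_zs/h.
- by move=> /rideal_zs /h' [? ?]; split; apply/rideal_zs.
Qed.

Lemma rideal_zsI0 u v :
  rideal u `&` rideal v = set0 <-> rideal u.1 `&` rideal v.1 = set0.
Proof.
split=> h; apply/seteqP; split=> // s [su sv].
- have : (rideal u `&` rideal v) (s, 1%g) by split; apply/rideal_zs.
  by rewrite h.
- have : (rideal u.1 `&` rideal v.1) s.1 by split; apply/rideal_zs.
  by rewrite h.
Qed.

(** Both sides are [xget] on the same set with the same default: products in X ⋈ G are [x] times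
    [beta u.2 y], and since [beta] is invertible every element of a fibre of [X] is such a
    [beta u.2 y]. *)
Lemma zs_incl u r (S : X u.1 -> X u.1) :
  @ps_incl R A _ Y u r S = @ps_incl R A _ X u.1 r.1 S.
Proof.
refine (congr1 (@xget {classic (X r.1 -> X r.1)} id) _).
apply/seteqP; split=> S' /= [aS' hS']; rewrite zs_adjointable in aS' *; split=> //.
- move=> q x y z zxy.
  set s := zact Z u.2^-1%g q.
  (* The second coordinate is chosen so that [(u * v)%g = r]. *)
  pose v : zs_prod Z := (s, ((zres Z s u.2)^-1 * r.2)%g).
  have yE : elt (beta u.2 (beta u.2^-1%g y)) = elt y.
    by rewrite (beta_comp hbeta) mulgV (beta_1 hbeta).
  have mulE (x' : X u.1) :
      elt (ps_mul x' (beta u.2 (beta u.2^-1%g y))) = elt (ps_mul x' y).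
    exact: (elt_congr (fun p w => elt (ps_mul x' w))) yE.
  have zE : elt (z : Y r) = elt (ps_mul (x : Y u) (beta u.2^-1%g y : Y v)).
    apply/elt_zs; split; last by rewrite zxy -mulE.
    have := congr1 (@projT1 _ _) zxy => /= rE.
    rewrite [r]surjective_pairing rE zs_mulE /=.
    by rewrite /s -zactM mulgV zact1p mulgA mulgV mul1g.
  by have /elt_zs[_ /= ->] := hS' v x _ z zE; exact: mulE.
- move=> v x y z /elt_zs[rE zxy]; apply/elt_zs; split=> //.
  exact: hS' zxy.
Qed.

Lemma zs_join u v r (S : X u.1 -> X u.1) (T : X v.1 -> X v.1) :
  @ps_join R A _ Y u v r S T = @ps_join R A _ X u.1 v.1 r.1 S T.
Proof. by rewrite /ps_join !zs_incl. Qed.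

(** * Induced maps on compact operators *)

Variables (Psi : forall u : zs_prod Z, Y u -> B).
Variables (psi : forall p : P, X p -> B) (U : G -> B).
Hypothesis hU : is_unitary_representation U.
Hypothesis hPsi : corresponds Psi psi U.

(** The same maps are induced by [Psi] and by [psi], so [xget] selects the same one. *)
Lemma zs_rep_compacts u (S : X u.1 -> X u.1) :
  rep_compacts Psi (S : Y u -> Y u) = rep_compacts psi S.
Proof.
(* [Psi x] is [psi x ** U g], and [U g ** star (U g)] cancels in the middle. *)
have PsiE (x y : X u.1) :
    Psi (x : Y u) ** star (Psi (y : Y u)) = psi x ** star (psi y).
  case: u x y {S} => p g x y.
  rewrite (corresponds_Psi hPsi g x) (corresponds_Psi hPsi g y) starM.
  by rewrite -cmulA (cmulA (U g)) (urep_coisometry hU) cmul1r.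
have -> // : @rep_compacts R A B _ Y Psi u = @rep_compacts R A B _ X psi u.1.
refine (congr1 (@xget {classic ((X u.1 -> X u.1) -> B)} (fun=> 0)) _).
apply/seteqP; split=> phi /= [hD hZ hM hs ht].
  split; rewrite ?zs_compacts in hD hZ hM hs *=> //.
  - by move=> S1 S2 cS aS; apply: hs => //; apply/zs_adjoint.
  - by move=> x y; rewrite -zs_theta ht PsiE.
split; rewrite ?zs_compacts //.
- by move=> S1 S2 cS aS; apply: hs => //; apply/zs_adjoint.
- by move=> x y; rewrite zs_theta ht -PsiE.
Qed.

End ZappaSzepSystem.

Theorem theorem4p14
  (R : realType) (P : monoidType) (G : groupType) (Z : zappa_szep P G)
  (hP : is_right_LCM P)
  (A B : cstarAlgType R)
  (X : product_system A P)
  (hX : is_product_system X)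
  (hXc : is_compactly_aligned X)
  (beta : forall (g : G) (p : P), X p -> X (zact Z g p))
  (hbeta : is_zs_action beta)
  (Psi : forall u : zs_prod Z, zs_system beta u -> B)
  (hPsi : is_representation Psi)
  (psi : forall p : P, X p -> B) (U : G -> B)
  (hpsi : is_covariant_representation beta psi U)
  (hPsipsi : corresponds Psi psi U) :
  is_Nica_covariant Psi <-> is_Nica_covariant psi.
Proof.
have hU := cov_unitary hpsi.
have repE u := @zs_rep_compacts R A B P G Z X beta hX hbeta Psi psi U hU hPsipsi u.
have joinE := @zs_join R A P G Z X beta hX hbeta.
have cE := @zs_compacts R A P G Z X beta hX hbeta.
split=> h.
  move=> p q S T cS cT.
  (* The carriers over [(p, 1%g)] and [(q, 1%g)] are [X p] and [X q] by conversion; a generator [r]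
     is lifted to [(r, 1%g)]. *)
  have := h (p, 1%g) (q, 1%g) S T; rewrite !cE => /(_ cS cT)[hr h0].
  split=> [r rE|rE].
    have := hr (r, 1%g); rewrite joinE !repE; apply; exact/rideal_zsI.
  by have := h0; rewrite !repE; apply; apply/rideal_zsI0.
move=> u v S T; rewrite !cE => cS cT; have [hr h0] := h u.1 v.1 S T cS cT.
split=> [r rE|rE].
  by rewrite joinE !repE; apply: hr; apply/rideal_zsI.
by rewrite !repE; apply: h0; apply/rideal_zsI0.
Qed.
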